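(* Let $d,n\ge 1$ be integers and let $Q\in M_d(\mathbb{C})$ be a matrix which has $d$ distinct eigenvalues $\lambda_1,\lambda_2,\dots,\lambda_d$. Suppose that $T\in M_d(\mathbb{C})$ is an invertible matrix with $T^{-1}QT=\mathrm{diag}(\lambda_1,\lambda_2,\dots,\lambda_d)$. Let $A_1,\dots,A_n\in C(Q)$, with representation polynomials $f_1(x),f_2(x),\dots,f_n(x)$, respectively. For $i=1,2,\dots,d$ put $$g_i(x)=x^n+f_1(\lambda_i)x^{n-1}+f_2(\lambda_i)x^{n-2}+\dots+f_{n-1}(\lambda_i)x+f_n(\lambda_i).$$ Then the set of all solutions $X\in C(Q)$ of the equation $$X^n+A_1X^{n-1}+A_2X^{n-2}+\dots+A_{n-1}X+A_n=O$$ is $$\left\{T\,\mathrm{diag}(u_1,u_2,\dots,u_d)\,T^{-1}: u_1,\dots,u_d\in\mathbb{C},\ g_i(u_i)=0 \text{ for } i=1,2,\dots,d\right\}.$$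
   Context: For $Q\in M_d(\mathbb{C})$, $C(Q)=\{X\in M_d(\mathbb{C}): QX=XQ\}$. A matrix is non-derogatory if each of its eigenvalues has geometric multiplicity $1$ (in particular, a $d\times d$ matrix with $d$ distinct eigenvalues is non-derogatory). For non-derogatory $Q$, the elements of $C(Q)$ are called $Q$-circulant matrices; it is known that $C(Q)$ is a commutative $\mathbb{C}$-algebra with $\mathbb{C}$-basis $\{I,Q,Q^2,\dots,Q^{d-1}\}$. If $A\in C(Q)$ is written (uniquely) as $A=\sum_{i=0}^{d-1}a_iQ^i$ with $a_i\in\mathbb{C}$, the polynomial $\sum_{i=0}^{d-1}a_ix^i$ is called the representation polynomial of $A$. $O$ denotes the $d\times d$ zero matrix. *)

(* Defs.v *)
From mathcomp Require Import all_boot all_order all_algebra.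
From mathcomp Require Import classical_sets reals.
From mathcomp Require Import complex.

Set Implicit Arguments.
Unset Strict Implicit.
Unset Printing Implicit Defensive.

Import GRing.Theory.
Local Open Scope ring_scope.

Section Circulant.
Variables (F : fieldType) (d : nat).
Implicit Types (Q X A : 'M[F]_d) (f : {poly F}).

Definition commutant Q : set 'M[F]_d := [set X | comm_mx Q X]%classic.

(* [size f <= d] says that f has degree at most d - 1. *)
Definition is_repr_poly Q A f : Prop :=
  (size f <= d)%N /\ A = \sum_(i < d) f`_i *: Q ^+ i.

End Circulant.

(* The coefficient families are indexed from 0, so [A k] and [f k] stand for
   A_(k+1) and f_(k+1), the coefficients of degree n - (k+1). *)
Section Equations.
Variables (F : fieldType) (d n : nat).

Definition mx_monic_eval (A : 'I_n -> 'M[F]_d) (X : 'M[F]_d) : 'M[F]_d :=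
  X ^+ n + \sum_(k < n) A k *m X ^+ (n - k.+1).

Definition eigen_poly (f : 'I_n -> {poly F}) (a : F) : {poly F} :=
  'X^n + \sum_(k < n) (f k).[a] *: 'X^(n - k.+1).

End Equations.

(* Main.v *)
Require Import Defs.
From mathcomp Require Import all_boot all_order all_algebra.
From mathcomp Require Import classical_sets reals.
From mathcomp Require Import complex.

Set Implicit Arguments.
Unset Strict Implicit.
Unset Printing Implicit Defensive.

Import GRing.Theory.
Local Open Scope ring_scope.
Local Open Scope classical_set_scope.

(** Conjugation by [T] turns [Q] into a diagonal matrix with distinct entries,
    and the only matrices commuting with such a matrix are diagonal
    ([comm_diag_mx_distinct]). So [C(Q)] is exactly the image of the map
    [u |-> T *m diag_mx u *m invmx T], which is an injective algebra morphism
    from the row vectors with entrywise operations ([spectral_mxM],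
    [spectral_mx_eq0]). Since [Q] is the image of [lambda], a polynomial [f]
    in [Q] is the image of the vector of the values [f.[lambda 0 i]]
    ([spectral_mx_repr]). The matrix equation thus splits into [d] independent
    scalar equations, the [i]-th of which says that [u 0 i] is a root of
    [eigen_poly f (lambda 0 i)] ([mx_monic_eval_spectral]). *)

Section SpectralMatrices.
Variables (F : fieldType) (d : nat) (T : 'M[F]_d).
Hypothesis T_unit : T \in unitmx.
Implicit Types (u v : 'rV[F]_d) (X Q : 'M[F]_d).

Definition spectral_mx u : 'M[F]_d := T *m diag_mx u *m invmx T.

Lemma spectral_mxD u v : spectral_mx (u + v) = spectral_mx u + spectral_mx v.
Proof. by rewrite /spectral_mx linearD mulmxDr mulmxDl. Qed.

Lemma spectral_mxZ a u : spectral_mx (a *: u) = a *: spectral_mx u.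
Proof. by rewrite /spectral_mx linearZ -scalemxAr -scalemxAl. Qed.

Lemma spectral_mx0 : spectral_mx 0 = 0.
Proof. by rewrite /spectral_mx linear0 mulmx0 mul0mx. Qed.

Lemma spectral_mx_sum (I : Type) (r : seq I) (P : pred I) (w : I -> 'rV[F]_d) :
  spectral_mx (\sum_(i <- r | P i) w i) = \sum_(i <- r | P i) spectral_mx (w i).
Proof. exact: (big_morph spectral_mx spectral_mxD spectral_mx0). Qed.

Lemma spectral_mxM u v :
  spectral_mx u *m spectral_mx v = spectral_mx (\row_i (u 0 i * v 0 i)).
Proof.
by rewrite /spectral_mx !mulmxA mulmxKV // -(mulmxA T) mulmx_diag.
Qed.

Lemma spectral_mxX u k :
  spectral_mx u ^+ k = spectral_mx (\row_i (u 0 i ^+ k)).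
Proof.
elim: k => [|k IHk].
  rewrite expr0 /spectral_mx (_ : \row_i _ = const_mx 1); last first.
    by apply/rowP => i; rewrite !mxE expr0.
  by rewrite diag_const_mx mulmx1 mulmxV.
rewrite exprS IHk [LHS]spectral_mxM; congr spectral_mx.
by apply/rowP => i; rewrite !mxE exprS.
Qed.

Lemma spectral_mx_eq0 u : spectral_mx u = 0 -> u = 0.
Proof.
move=> u0; have D0 : diag_mx u = 0.
  have: invmx T *m spectral_mx u *m T = 0 by rewrite u0 mulmx0 mul0mx.
  by rewrite /spectral_mx !mulmxA mulVmx // mul1mx mulmxKV.
by apply/rowP => i; move/matrixP/(_ i i): D0; rewrite !mxE eqxx.
Qed.

(** The bound on [size f] in [is_repr_poly] is what makes the sum over ['I_d]
    of the powers evaluate to [f] itself and not to a truncation of it. *)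
Lemma spectral_mx_repr u A (f : {poly F}) :
  is_repr_poly (spectral_mx u) A f -> A = spectral_mx (\row_i f.[u 0 i]).
Proof.
move=> [sz_f ->]; rewrite (eq_bigr (fun j : 'I_d =>
  spectral_mx (f`_j *: \row_i (u 0 i ^+ j)))); last first.
  by move=> j _; rewrite spectral_mxX spectral_mxZ.
rewrite -spectral_mx_sum; congr spectral_mx.
apply/rowP => i; rewrite mxE summxE (horner_coef_wide _ sz_f).
by apply: eq_bigr => j _; rewrite !mxE.
Qed.

Lemma mx_monic_eval_spectral n (A : 'I_n -> 'M[F]_d) (f : 'I_n -> {poly F})
    (l u : 'rV[F]_d) :
  (forall k, A k = spectral_mx (\row_i (f k).[l 0 i])) ->
  mx_monic_eval A (spectral_mx u)
    = spectral_mx (\row_i (eigen_poly f (l 0 i)).[u 0 i]).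
Proof.
move=> defA; rewrite /mx_monic_eval spectral_mxX.
rewrite (eq_bigr (fun k : 'I_n =>
  spectral_mx (\row_i ((f k).[l 0 i] * u 0 i ^+ (n - k.+1))))); last first.
  move=> k _; rewrite defA spectral_mxX spectral_mxM; congr spectral_mx.
  by apply/rowP => i; rewrite !mxE.
rewrite -spectral_mx_sum -spectral_mxD; congr spectral_mx.
apply/rowP => i; rewrite !mxE summxE /eigen_poly hornerD hornerXn horner_sum.
by congr (_ + _); apply: eq_bigr => k _; rewrite mxE hornerZ hornerXn.
Qed.

(** Comparing the entries [(i, j)] of the two products gives
    [(l 0 i - l 0 j) * Y i j = 0]. *)
Lemma comm_diag_mx_distinct (l : 'rV[F]_d) (Y : 'M[F]_d) :
  injective (l 0) -> comm_mx (diag_mx l) Y -> Y = diag_mx (\row_i Y i i).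
Proof.
move=> l_inj /matrixP cY; apply/matrixP => i j; rewrite !mxE.
have [-> | neq_ij] := eqVneq i j; first by rewrite mulr1n.
move: (cY i j); rewrite mul_diag_mx mul_mx_diag !mxE [RHS]mulrC => /eqP.
rewrite -subr_eq0 -mulrBl mulf_eq0 subr_eq0 => /orP[/eqP/l_inj eq_ij | /eqP //].
by rewrite eq_ij eqxx in neq_ij.
Qed.

(** Conjugating [X] by [T] reduces this to [comm_diag_mx_distinct]. *)
Lemma commutant_spectralP (l : 'rV[F]_d) X :
  injective (l 0) ->
  commutant (spectral_mx l) X <-> exists u, X = spectral_mx u.
Proof.
move=> l_inj; split=> [cX | [u ->]]; last first.
  rewrite /commutant /= /comm_mx !spectral_mxM; congr spectral_mx.
  by apply/rowP => i; rewrite !mxE mulrC.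
pose Y := invmx T *m X *m T.
have defX : X = T *m Y *m invmx T.
  by rewrite /Y !mulmxA mulmxV // mul1mx mulmxK.
exists (\row_i Y i i); rewrite /spectral_mx -(@comm_diag_mx_distinct l) //.
move: cX; rewrite /commutant /= /comm_mx /spectral_mx => cX.
have -> : diag_mx l = invmx T *m (T *m diag_mx l *m invmx T) *m T.
  by rewrite !mulmxA mulVmx // mul1mx mulmxKV.
(* From here on the conjugate of [diag_mx l] is just a matrix that commutes
   with [X]. *)
move: (T *m _ *m _) cX => Q cX.
by rewrite /Y !mulmxA !mulmxK // -!(mulmxA (invmx T)) cX.
Qed.

End SpectralMatrices.

Theorem theorem1p1 (R : realType) (d n : nat) (d_gt0 : (0 < d)%N)
    (n_gt0 : (0 < n)%N) (Q : 'M[R[i]]_d) (lambda : 'rV[R[i]]_d)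
    (lambda_distinct : injective (lambda 0))
    (lambda_eigen : forall i : 'I_d, eigenvalue Q (lambda 0 i))
    (T : 'M[R[i]]_d) (T_unit : T \in unitmx)
    (T_diag : invmx T *m Q *m T = diag_mx lambda)
    (A : 'I_n -> 'M[R[i]]_d) (f : 'I_n -> {poly R[i]})
    (A_circ : forall k : 'I_n, commutant Q (A k))
    (f_repr : forall k : 'I_n, is_repr_poly Q (A k) (f k)) :
  [set X | commutant Q X /\ mx_monic_eval A X = 0] =
  [set T *m diag_mx u *m invmx T | u in
    [set u : 'rV[R[i]]_d |
      forall i : 'I_d, (eigen_poly f (lambda 0 i)).[u 0 i] = 0]].
Proof.
have defQ : Q = spectral_mx T lambda.
  by rewrite /spectral_mx -T_diag !mulmxA mulmxV // mul1mx mulmxK.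
have defA k : A k = spectral_mx T (\row_i (f k).[lambda 0 i]).
  by apply: spectral_mx_repr => //; rewrite -defQ.
have evalE := mx_monic_eval_spectral T_unit _ defA.
apply/seteqP; split=> [X [] | X [u /= root_u <-]].
  rewrite defQ => /(commutant_spectralP T_unit _ lambda_distinct)[u ->].
  rewrite evalE => /(spectral_mx_eq0 T_unit)/rowP root_u.
  by exists u => // i; have := root_u i; rewrite !mxE.
split; last first.
  rewrite -/(spectral_mx T u) evalE (_ : \row_i _ = 0) ?spectral_mx0 //.
  by apply/rowP => i; rewrite !mxE root_u.
by rewrite defQ; apply/(commutant_spectralP T_unit _ lambda_distinct); exists u.
Qed.
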